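(* Let $l$ be any integer such that $0\le l\le 4$, and let $i,k\in\{0,1\}$. Let $J_{i,k}(X,l)$ be the number of solutions of the equation $n-5m=l$ in positive integers $m,n$ with $m\le X$, $m\in\mathbb{N}_i$, $n\in\mathbb{N}_k$. Then, as $X\to\infty$, $$J_{i,k}(X,l)=\frac{X}{4}+O(X^\lambda),\qquad \lambda=\frac{\ln 3}{\ln 4}=0.7924818\ldots$$
   Context: For a positive integer $n$ write its binary expansion $n=\sum_{k=0}^\infty \varepsilon_k 2^k$ with $\varepsilon_k\in\{0,1\}$. The set of positive integers is split into two disjoint classes: $\mathbb{N}_0$ is the set of positive integers $n$ with $\sum_{k=0}^\infty\varepsilon_k\equiv 0\pmod 2$, and $\mathbb{N}_1$ is the set of positive integers $n$ with $\sum_{k=0}^\infty\varepsilon_k\equiv 1\pmod 2$. *)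

(* Defs.v *)
From HB Require Import structures.
From mathcomp Require Import all_boot all_order all_algebra finmap.
From mathcomp Require Import all_classical all_reals all_analysis.

Set Implicit Arguments.
Unset Strict Implicit.
Unset Printing Implicit Defensive.

Import Order.TTheory GRing.Theory Num.Theory.
Import numFieldNormedType.Exports.

Local Open Scope classical_set_scope.
Local Open Scope ring_scope.

Definition binary_digit (n k : nat) : nat := ((n %/ 2 ^ k) %% 2)%N.

(* The sum over all k reduces to k < n, as n < 2 ^ n. *)
Definition binary_digit_sum (n : nat) : nat :=
  (\sum_(k < n) binary_digit n k)%N.

Definition Nclass (i : 'I_2) : set nat :=
  [set n | (0 < n)%N /\ binary_digit_sum n = i %[mod 2]].

Definition solutions (R : realType) (i k : 'I_2) (X : R) (l : int) :
    set (nat * nat) :=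
  [set p | let: (m, n) := p in
     [/\ m%:R <= X, Nclass i m, Nclass k n & n%:Z - 5 * m%:Z = l]].

(* fset_set is a junk value (empty) on infinite sets; this rules it out. *)
Lemma finite_solutions (R : realType) (i k : 'I_2) (X : R) (l : int) :
  finite_set (solutions i k X l).
Proof.
pose f (m : nat) := (m, absz (5 * m%:Z + l)).
apply: (@sub_finite_set _ _ (f @` `I_(Num.truncn X).+1)); last first.
  exact/finite_image/finite_II.
move=> [m n] [mX _ _ e]; exists m => /=.
  by rewrite ltnS -(@natrK R m) Num.Theory.le_truncn.
by rewrite /f -e addrC subrK absz_nat.
Qed.

Definition J (R : realType) (i k : 'I_2) (X : R) (l : int) : nat :=
  #|` fset_set (solutions i k X l) |.

(* The Landau notations need a packed filter, which the library lacks for +oo. *)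
Canonical pinfty_nbhs_filter_on (R : numFieldType) :=
  FilterType (pinfty_nbhs R) _.

(* Main.v *)
(* Let t be the Thue-Morse sign.  Detecting the classes of m and n = 5m + l by
   (1 +- t)/2 reduces the theorem to bounds for the sums over m < N of t(m),
   which is bounded, and of t(m)^a t(5m + l) with a = 0, 1.  Splitting m by
   parity expresses the latter sums up to 2N, for the five residues l, as signed
   combinations of those up to N.  After four doublings the coefficients of each
   combination have absolute sum at most 8, while 16^(ln 3 / ln 4) = 9; the
   estimate follows by induction on N. *)
Require Import Defs.
From HB Require Import structures.
From mathcomp Require Import all_boot all_order all_algebra finmap.
From mathcomp Require Import all_classical all_reals all_analysis.
From mathcomp Require Import zify ring lra.

Import Order.TTheory GRing.Theory Num.Theory.
Import numFieldNormedType.Exports.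

Local Open Scope classical_set_scope.
Local Open Scope ring_scope.

(** * Binary digit sums and the Thue-Morse sign *)

Lemma binary_digit_sum_widen (n K : nat) : (n <= K)%N ->
  binary_digit_sum n = (\sum_(k < K) binary_digit n k)%N.
Proof.
move=> nK; rewrite /binary_digit_sum (big_ord_widen K (binary_digit n) nK).
rewrite [RHS](bigID (fun k : 'I_K => (k < n)%N)) /= [X in (_ + X)%N]big1 ?addn0//.
move=> k; rewrite -leqNgt => nk.
have n2k : (n < 2 ^ k)%N := leq_ltn_trans nk (ltn_expl k (isT : (1 < 2)%N)).
by rewrite /binary_digit (divn_small n2k).
Qed.

(** Doubling shifts every digit up one place and [b] becomes the lowest one; widening both sums
    first makes their ranges match after the lowest digit is split off. *)
Lemma binary_digit_sum_double (b : bool) (n : nat) :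
  binary_digit_sum (n.*2 + b) = (b + binary_digit_sum n)%N.
Proof.
rewrite (@binary_digit_sum_widen _ (n.*2 + b).+1)// big_ord_recl /=.
rewrite (@binary_digit_sum_widen n (n.*2 + b)%N); last by lia.
congr (_ + _)%N; first by rewrite /binary_digit expn0 divn1; lia.
apply: eq_bigr => k _; rewrite /binary_digit /= /bump /= add1n expnS divnMA.
by congr ((_ %/ _) %% _)%N; lia.
Qed.

Definition thue_morse (n : nat) : int := (-1) ^+ binary_digit_sum n.

Lemma thue_morse_double (b : bool) (n : nat) :
  thue_morse (n.*2 + b) = (-1) ^+ b * thue_morse n.
Proof. by rewrite /thue_morse binary_digit_sum_double exprD. Qed.

Lemma thue_morse_even (n : nat) : thue_morse n.*2 = thue_morse n.
Proof. by have := thue_morse_double false n; rewrite addn0 mul1r. Qed.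

Lemma thue_morse_odd (n : nat) : thue_morse n.*2.+1 = - thue_morse n.
Proof. by have := thue_morse_double true n; rewrite addn1 mulN1r. Qed.

Lemma normr_thue_morse (n : nat) : `|thue_morse n| = 1.
Proof. exact: normr_sign. Qed.

Lemma thue_morse_parity (i : 'I_2) (n : nat) :
  (binary_digit_sum n == i %[mod 2]) = (thue_morse n == (-1) ^+ i).
Proof.
rewrite /thue_morse -signr_odd -[in RHS](signr_odd _ i) (inj_eq (@signr_inj _)).
by rewrite !modn2; do 2!case: odd.
Qed.

(** * Sums of signs under doubling *)

Lemma sum_double (V : nmodType) (F : nat -> V) (N : nat) :
  \sum_(m < N.*2) F m = \sum_(m < N) (F m.*2 + F m.*2.+1).
Proof.
elim: N => [|N IH]; first by rewrite !big_ord0.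
by rewrite doubleS !big_ord_recr /= IH addrA.
Qed.

(** The signs at [2m] and [2m + 1] cancel, so at most one term is left over. *)
Lemma thue_morse_sum_bound (N : nat) : `|\sum_(m < N) thue_morse m| <= 1.
Proof.
have sum0 q : \sum_(m < q.*2) thue_morse m = 0.
  rewrite sum_double big1// => m _.
  by rewrite thue_morse_even thue_morse_odd addrN.
rewrite -(odd_double_half N); case: (odd N) => /=.
  by rewrite add1n big_ord_recr /= sum0 add0r normr_thue_morse.
by rewrite add0n sum0 normr0.
Qed.

(** The exponent [a] lets one recursion serve the sums with and without the factor
    [thue_morse m]. *)
Definition correlation (a : bool) (l N : nat) : int :=
  \sum_(m < N) thue_morse m ^+ a * thue_morse (5 * m + l).

Lemma correlation_double (a : bool) (l N : nat) :
  correlation a l N.*2 =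
  (-1) ^+ l * (correlation a l./2 N - (-1) ^+ a * correlation a (l + 5)./2 N).
Proof.
rewrite /correlation
  (sum_double _ (fun m => thue_morse m ^+ a * thue_morse (5 * m + l))).
rewrite [in RHS]mulr_sumr -sumrB mulr_sumr.
apply: eq_bigr => m _.
have -> : (5 * m.*2 + l = (5 * m + l./2).*2 + odd l)%N by lia.
have -> : (5 * m.*2.+1 + l = (5 * m + (l + 5)./2).*2 + ~~ odd l)%N by lia.
rewrite thue_morse_even thue_morse_odd !thue_morse_double.
rewrite -(signr_odd _ l); case: (odd l); case: a => /=; ring.
Qed.

(** The shifts [l./2] and [(l + 5)./2] stay below 5, so the five sums form a closed system. Four
    doublings produce 16 signed terms, of which enough cancel to halve the trivial bound
    [16 * c]. *)
Lemma correlation_16 (a : bool) (N : nat) (c : int) :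
  (forall l, (l < 5)%N -> `|correlation a l N| <= c) ->
  forall l, (l < 5)%N -> `|correlation a l (16 * N)| <= 8 * c.
Proof.
move=> bnd l l5; have -> : (16 * N = N.*2.*2.*2.*2)%N by lia.
have := bnd 4 isT; have := bnd 3 isT; have := bnd 2 isT.
have := bnd 1 isT; have := bnd 0 isT; rewrite !ler_norml {bnd}.
case: a => /andP[? ?] /andP[? ?] /andP[? ?] /andP[? ?] /andP[? ?];
  case: l l5 => [|[|[|[|[|l]]]]] // _; rewrite !correlation_double /=;
  (* Each goal is now linear in the five sums up to [N], all of which lie between [- c] and [c]. *)
  rewrite ?expr0 ?expr1; apply/andP; split; lra.
Qed.

Lemma correlation_le (a : bool) (l N r : nat) :
  `|correlation a l (N + r)| <= `|correlation a l N| + r%:Z.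
Proof.
rewrite /correlation big_split_ord /=; apply: le_trans (ler_normD _ _) _.
rewrite lerD2l; apply: le_trans (ler_norm_sum _ _ _) _.
rewrite (eq_bigr (fun=> 1)) ?sumr_const ?card_ord ?natz// => i _.
by rewrite normrM normrX !normr_thue_morse expr1n mulr1.
Qed.

(** * The power bound for the correlations *)

Lemma ln3_ln4_ge0 (R : realType) : 0 <= ln 3 / ln 4 :> R.
Proof. by rewrite divr_ge0// ln_ge0// ler1n. Qed.

Lemma powR16_ln3_ln4 (R : realType) : 16 `^ (ln 3 / ln 4) = 9 :> R.
Proof.
have ln4 : ln 4 != 0 :> R by rewrite gt_eqF// ln_gt0// ltr1n.
have pow4 : 4 `^ (ln 3 / ln 4) = 3 :> R.
  by rewrite /powR pnatr_eq0 /= divfK// lnK// posrE ltr0n.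
have -> : 16 = 4 * 4 :> R by ring.
by rewrite powRM// pow4; ring.
Qed.

(** Strong induction from [N %/ 16] to [N]: the factor 8 and the at most 15 leftover terms must fit
    under the growth factor 9. Any constant from 15 on would do; 135 leaves room. *)
Lemma correlation_bound (R : realType) (a : bool) (l N : nat) : (l < 5)%N ->
  `|correlation a l N|%:~R <= 135 * N%:R `^ (ln 3 / ln 4) :> R.
Proof.
elim/ltn_ind: N l => N IH l l5; have [N16|N16] := ltnP N 16.
  have [->|N0] := posnP N.
    by rewrite /correlation big_ord0 normr0 mulr_ge0// powR_ge0.
  have corrN : `|correlation a l N| <= 15.
    have := correlation_le a l 0 N; rewrite add0n {2}/correlation big_ord0 normr0.
    by lia.
  have N1 : 1 <= N%:R `^ (ln 3 / ln 4) :> R.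
    rewrite -[leLHS](powRr0 N%:R) ler_powR ?ln3_ln4_ge0//.
    by rewrite ler1n.
  apply: (@le_trans _ _ 15%:~R); first by rewrite ler_int.
  lra.
set q := (N %/ 16)%N; have q0 : (0 < q)%N by rewrite divn_gt0.
set c : R := 135 * q%:R `^ (ln 3 / ln 4).
have corr16 : `|correlation a l (16 * q)|%:~R <= 8 * c.
  (* [correlation_16] takes an integer bound; since the correlations are integers, the floor of [c]
     bounds them as well. *)
  apply: (@le_trans _ _ (8 * Num.floor c)%:~R); last first.
    by rewrite intrM ler_pM2l// ge_floor.
  rewrite ler_int; apply: correlation_16 => // j j5.
  by rewrite floor_ge_int; apply: IH => //; rewrite /q; lia.
have corrN : `|correlation a l N|%:~R <= 8 * c + 15.
  apply: (@le_trans _ _ (`|correlation a l (16 * q)| + 15)%:~R); last first.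
    by rewrite intrD lerD2r.
  rewrite ler_int.
  apply: (@le_trans _ _ (`|correlation a l (16 * q)| + (N %% 16)%:Z)).
    by rewrite {1}(divn_eq N 16) mulnC; exact: correlation_le.
  by lia.
have c135 : 135 <= c.
  rewrite /c ler_peMr// -[leLHS](powRr0 q%:R) ler_powR ?ln3_ln4_ge0//.
  by rewrite ler1n.
have qN : 9 * q%:R `^ (ln 3 / ln 4) <= N%:R `^ (ln 3 / ln 4) :> R.
  rewrite -powR16_ln3_ln4 -powRM// ge0_ler_powR ?nnegrE ?ln3_ln4_ge0//.
  by rewrite -natrM ler_nat /q; lia.
(* The spare copy of [c] in [9 * c] absorbs the 15. *)
rewrite /c in corrN c135; lra.
Qed.

(** * Counting solutions by signs *)

Lemma Nclass_thue_morse (i : 'I_2) (n : nat) :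
  Nclass i n <-> ((0 < n)%N && (thue_morse n == (-1) ^+ i)).
Proof.
rewrite -thue_morse_parity; split => [[n0 /eqP e]|/andP[n0 /eqP e]] //.
by apply/andP.
Qed.

(** The solutions lie on the graph of [m |-> 5 * m + l], so counting pairs amounts to counting
    [m]. *)
Lemma J_sum (R : realType) (i k : 'I_2) (X : R) (l : nat) : 0 <= X ->
  J i k X l%:Z = (\sum_(m < (Num.truncn X).+1)
    [&& 0 < m, thue_morse m == (-1) ^+ i & thue_morse (5 * m + l) == (-1) ^+ k])%N.
Proof.
move=> X0; pose P (m : nat) := [&& (0 < m)%N,
  thue_morse m == (-1) ^+ i & thue_morse (5 * m + l) == (-1) ^+ k].
pose f m := (m, (5 * m + l)%N).
pose s := [seq f m | m <- index_iota 0 (Num.truncn X).+1 & P m].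
transitivity (size s); last first.
  rewrite size_map -sum1_size big_filter big_mkcond.
  by rewrite (big_mkord xpredT); apply: eq_bigr => m _; rewrite -/(P m); case: (P m).
rewrite /J; have -> : solutions i k X l%:Z = [set` [fset x in s]%fset].
  apply/seteqP; split => -[m n] /=.
    move=> [mX /Nclass_thue_morse /andP[m0 mi] /Nclass_thue_morse /andP[n0 nk] e].
    have en : n = (5 * m + l)%N by lia.
    rewrite in_fset; apply/mapP; exists m; last by rewrite /f en.
    rewrite mem_filter mem_index_iota /= ltnS truncn_ge_nat// mX andbT.
    by rewrite /P m0 mi -en.
  rewrite in_fset => /mapP[p]; rewrite mem_filter mem_index_iota /= ltnS.
  rewrite truncn_ge_nat// => /andP[/and3P[p0 pi pk] pX] [-> ->].
  split => //; [| |by lia]; apply/Nclass_thue_morse; rewrite ?p0 ?pi//.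
  by rewrite pk andbT; lia.
rewrite set_fsetK card_fseq undup_id// map_inj_uniq ?filter_uniq ?iota_uniq//.
by move=> x y [].
Qed.

(** This is the expanded product of the two factors [1 + (-1) ^+ i * thue_morse s] and
    [1 + (-1) ^+ k * thue_morse t], each of which is 2 or 0. *)
Lemma four_indicators (s t : nat) (i k : 'I_2) :
  (4 * ((thue_morse s == (-1) ^+ i) && (thue_morse t == (-1) ^+ k)))%:Z =
  1 + (-1) ^+ i * thue_morse s + (-1) ^+ k * thue_morse t
    + (-1) ^+ i * (-1) ^+ k * (thue_morse s * thue_morse t).
Proof.
rewrite /thue_morse -(signr_odd _ i) -(signr_odd _ k).
rewrite -(signr_odd _ (binary_digit_sum s)) -(signr_odd _ (binary_digit_sum t)).
by do 4!case: odd.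
Qed.

(** Of the 5, 4 pays for the term [m = 0], which [J] excludes but the full sums include, and 1 for
    the plain sum of signs. *)
Lemma J_bound (R : realType) (i k : 'I_2) (X : R) (l N : nat) :
  0 <= X -> (Num.truncn X).+1 = N ->
  `|(4 * J i k X l%:Z)%:Z - N%:Z|
    <= 5 + `|correlation false l N| + `|correlation true l N|.
Proof.
move=> X0 XN; rewrite J_sum// XN.
pose G m : int := (4 * ((thue_morse m == (-1) ^+ i) &&
  (thue_morse (5 * m + l) == (-1) ^+ k)))%N.
have G4 : `|G 0| <= 4 by rewrite /G; case: andb.
have -> : (4 * \sum_(m < N) [&& 0 < m, thue_morse m == (-1) ^+ i
    & thue_morse (5 * m + l) == (-1) ^+ k])%N%:Z = \sum_(m < N) G m - G 0%N.
  rewrite -XN !big_ord_recl /= add0n addrC addKr big_distrr /= -natz raddf_sum /=.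
  by apply: eq_bigr => m _; rewrite natz.
have -> : \sum_(m < N) G m = N%:Z + (-1) ^+ i * (\sum_(m < N) thue_morse m)
    + (-1) ^+ k * correlation false l N
    + (-1) ^+ i * (-1) ^+ k * correlation true l N.
  under eq_bigr do rewrite /G four_indicators.
  rewrite !big_split /= sumr_const card_ord natz -!mulr_sumr /correlation.
  by under [X in _ = _ + _ * X + _]eq_bigr do rewrite expr0 mul1r.
(* Moving the signs inside the absolute values makes each signed sum a single unknown for [lia]. *)
have sg (j : nat) (x : int) : `|(-1) ^+ j * x| = `|x|.
  by rewrite normrM normr_sign mul1r.
have := thue_morse_sum_bound N.
rewrite -(sg i (\sum_(m < N) _)) -(sg k (correlation false _ _)).
by rewrite -(sg (i + k)%N (correlation true _ _)) exprD; move: G4;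
  move: (G 0%N) (_ * \sum_(m < N) _) (_ * _) (_ * _) => g x y z; lia.
Qed.

Theorem theorem2 (R : realType) (l : int) (hl : 0 <= l <= 4) (i k : 'I_2) :
  (fun X : R => (J i k X l)%:R : R^o) =
  (fun X : R => X / 4 : R^o) +O_ +oo (fun X : R => X `^ (ln 3 / ln 4) : R^o).
Proof.
case: l hl => [l|l]; last by move=> /andP[].
rewrite lez_nat => /= l4; apply/eqaddOP.
(* The estimates below give [(2 * 135 * 9 + 6) / 4 = 609] for [X >= 1], so 1000 suffices. *)
exists 1000; split; first exact: num_real.
move=> c c1000; near=> X; rewrite !fctE.
have X1 : 1 <= X by near: X; exact: nbhs_pinfty_ge.
have X0 : 0 <= X by exact: le_trans X1.
set N := (Num.truncn X).+1.
have /andP[XN NX] := truncn_itv X0.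
have powX : 1 <= X `^ (ln 3 / ln 4).
  by rewrite -[leLHS](powRr0 X) ler_powR// ln3_ln4_ge0.
(* The crude bound [N <= X + 1 <= 16 * X] is used because the power of 16 is known exactly. *)
have powN : N%:R `^ (ln 3 / ln 4) <= 9 * X `^ (ln 3 / ln 4) :> R.
  rewrite -powR16_ln3_ln4 -powRM// ge0_ler_powR ?nnegrE ?ln3_ln4_ge0//.
    by rewrite mulr_ge0.
  by rewrite /N -natr1; lra.
have := @J_bound R i k X l N X0 erefl.
rewrite -(ler_int R) intr_norm !rmorphD rmorphN /=.
have := @correlation_bound R false l N l4.
have := @correlation_bound R true l N l4.
rewrite /= -!pmulrn (ger0_norm (le_trans ler01 powX)).
move=> trueN falseN; rewrite ler_norml => /andP[lo hi].
apply: (@le_trans _ _ (1000 * X `^ (ln 3 / ln 4))); last first.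
  by rewrite ler_wpM2r ?ltW// (lt_le_trans ltr01).
rewrite ler_norml; move: lo hi; rewrite /N -natr1 => lo hi.
by apply/andP; split; lra.
Unshelve. all: by end_near. Qed.
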